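(* Let $\mathcal{W}(J)$ be an $S\mathcal{W}$-subgroup of $\mathcal{W}$ and let $\mathcal{W}(J')$ be a good dual of $\mathcal{W}(J)$. The $K\mathcal{W}$-module $$D^{J}=S^{J,J'}/\bigl(S^{J,J'}\cap (S^{J,J'})^{\perp}\bigr)$$ is zero or irreducible, where $(S^{J,J'})^{\perp}$ is the orthogonal complement of $S^{J,J'}$ in $M^{\Delta}$ with respect to the bilinear form $\langle\,,\rangle$.
   Context: $\Phi$ is a root system (finite, reduced, crystallographic) in a finite-dimensional real Euclidean space, with simple system $\pi$ and Weyl group $\mathcal{W}=\mathcal{W}(\Phi)$; $l$ is the length function with respect to $\pi$ and $s(w)=(-1)^{l(w)}$. $K$ is an arbitrary field. Steinberg subgroups. Let $\Theta$ be a root system with simple system $\pi_\Theta$ and let $\rho$ be a symmetry of its Dynkin diagram, induced by an isometry $\tau$ of the ambient space such that $\tau(r)$ is a positive multiple of $\rho(r)$ for each $r\in\pi_\Theta$ (in types $B_2,F_4,G_2$ the symmetry may interchange long and short roots). Then $\mathcal{W}(\Theta)^1=\{w\in\mathcal{W}(\Theta):\tau w\tau^{-1}=w\}$ is the Steinberg subgroup; it acts faithfully, as a group generated by reflections, on the fixed space $V^1$ of $\tau$, and it is generated by the elements $w_0^{O}$, for $O$ running over the $\rho$-orbits in $\pi_\Theta$, where $w_0^{O}$ is the longest element of the subgroup generated by the reflections in the roots of $O$. Its roots are the projections of the roots of $\Theta$ to $V^1$ (one chosen from each class of positive multiples), and its simple roots are the projections of $\pi_\Theta$. Extended subsystems and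 $S\mathcal{W}$-subgroups. An extended subsystem $\Psi$ of $\Phi$, with simple system $J$ and Dynkin diagram $\Delta$, is a root system obtained (up to the action of $\mathcal{W}$) by the following algorithm: (i) form the extended Dynkin diagram of $\Phi$, by adding to the diagram a node corresponding to the negative of the highest root; (ii) delete one or more nodes in all possible ways; (iii) take a symmetry $\rho$ (possibly the identity) of the remaining Dynkin diagram and form the corresponding Steinberg subgroup with its root system; (iv) take also the duals of the diagrams obtained in the same way from the dual root system of $\Phi$ (long and short roots interchanged); (v) repeat the process with the diagrams obtained, any number of times (extending each connected component and deleting at least one node from each extended component). The subgroup $\mathcal{W}(J)$ of $\mathcal{W}$ generated by the reflections $\tau_\alpha$, $\alpha\in\Psi$ (for Steinberg subgroups: by the elements of $\mathcal{W}$ in the Steinberg subgroup which act as these reflections on $V^1$) is called a Steinberg–Weyl ($S\mathcal{W}$-) subgroup of $\mathcal{W}$. For $w\in\mathcal W$, $\mathcal{W}(wJ)=w\mathcal{W}(J)w^{-1}$. Tabloids and modules. Let $\mathcal{W}(J)$ be an $S\mathcal{W}$-subgroup. The $\Delta$-tabloids are the left cosets $\{w\mathcal{W}(J)\}$, $w\in\mathcal{W}$; $\mathcal{W}$ acts on them by left multiplication. $M^\Delta$ is the $K$-space with basis the $\Delta$-tabloids, a $K\mathcal{W}$-module. A useful dual of $\mathcal{W}(J)$ is an $S\mathcal{W}$-subgroup $\mathcal{W}(J')$ of $\mathcal{W}$ with $\mathcal{W}(J)\cap\mathcal{W}(J')=\langle e\rangle$. Put $\kappa_{J'}=\sum_{\sigma\in\mathcal{W}(J')}s(\sigma)\sigma$,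 $e_{J,J'}=\kappa_{J'}\{\mathcal{W}(J)\}$ and, for $w\in\mathcal{W}$, $e_{wJ,wJ'}=w\,e_{J,J'}=\kappa_{wJ'}\{w\mathcal{W}(J)\}$. $S^{J,J'}$ is the $K$-span in $M^\Delta$ of all $e_{wJ,wJ'}$, $w\in\mathcal{W}$ (a $K\mathcal{W}$-submodule). A useful dual $\mathcal{W}(J')$ is a good dual of $\mathcal{W}(J)$ if for every $w\in\mathcal{W}$ with $\kappa_{J'}\{w\mathcal{W}(J)\}\neq 0$, the tabloid $\{w\mathcal{W}(J)\}$ appears (with non-zero coefficient) in $e_{J,J'}$. Form: $\langle\,,\rangle$ is the bilinear form on $M^\Delta$ with $\langle\{w_1\mathcal{W}(J)\},\{w_2\mathcal{W}(J)\}\rangle=1$ if $w_1\mathcal{W}(J)=w_2\mathcal{W}(J)$ and $0$ otherwise. *)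

(* Defs.v *)
From HB Require Import structures.
From mathcomp Require Import all_boot all_order all_fingroup all_algebra.
From mathcomp Require Import mxrepresentation finmap.
From mathcomp Require Import boolp classical_sets reals.

Set Implicit Arguments.
Unset Strict Implicit.
Unset Printing Implicit Defensive.

Import Order.TTheory GRing.Theory Num.Theory GroupScope.
Local Open Scope fset_scope.
Local Open Scope ring_scope.

(* Groups act on the right throughout, as usual in MathComp: on row vectors by
   v *m g, and on points by permutations, with (s * t) x = t (s x).  So the
   composite "w after u" is u * w here, and the left coset w o H of a subgroup
   H is the right coset H :* w, on which "left multiplication by u" is
   H :* w |-> H :* (w * u). *)

Section RootSystems.
Variables (R : realType) (n : nat).
Local Notation V := 'rV[R]_n.
Implicit Types (a b r t v : V) (J C Phi Psi Theta : {fset V}).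

Definition dot v a : R := (v *m a^T) 0 0.
Lemma dotDl (k : R) u v a : dot (k *: u + v) a = k * dot u a + dot v a.
Proof. by rewrite /dot mulmxDl -scalemxAl 2!mxE. Qed.

Definition cartan a b : R := 2 * dot a b / dot b b.
Definition refl a v : V := v - cartan v a *: a.

(* Finite and reduced, but not necessarily crystallographic: the Steinberg
   subgroup of W(F4) has the dihedral root system of order 16. *)
Definition root_system Phi : Prop :=
  [/\ 0 \notin Phi,
      {in Phi &, forall a b, refl a b \in Phi}
    & {in Phi, forall a (c : R), c *: a \in Phi -> c = 1 \/ c = -1}].

Definition crystallographic Phi : Prop :=
  {in Phi &, forall a b, cartan a b \is a Num.int}.

Definition nneg_comb J v : Prop :=
  exists2 c : V -> R, (forall b, 0 <= c b) & v = \sum_(b <- J) c b *: b.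

Definition simple_system Phi J : Prop :=
  [/\ J `<=` Phi, free J
    & {in Phi, forall a, nneg_comb J a \/ nneg_comb J (- a)}].

(* Number of bonds joining two nodes of a Dynkin diagram. *)
Definition bonds a b : R := cartan a b * cartan b a.

(* C is a connected component of the Dynkin diagram with nodes J. *)
Definition component J C : Prop :=
  [/\ C `<=` J, C != fset0,
      (forall a b, a \in C -> b \in J `\` C -> dot a b = 0)
    & forall D : {fset V}, D `<` C -> D != fset0 ->
        exists a b, [/\ a \in D, b \in C `\` D & dot a b != 0]].

(* t is the highest root of the irreducible component of Psi with simple
   system C. *)
Definition highest_root Psi C t : Prop :=
  [/\ t \in Psi, t \in <<C>>%VS
    & forall a, a \in Psi -> a \in <<C>>%VS -> nneg_comb C (t - a)].

(* J1 is what remains of the extended Dynkin diagram of (Psi, J) after at least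
   one node of every extended component has been deleted. *)
Definition extended_deletion Psi J J1 : Prop :=
  (forall b, b \in J1 ->
     b \in J \/ exists2 C, component J C & highest_root Psi C (- b)) /\
  (forall C t, component J C -> highest_root Psi C t ->
     ~~ ((- t) |` C `<=` J1)).

(* Membership in W(J) J, the root system with simple system J. *)
Inductive generated_root J : V -> Prop :=
| GenBase a : a \in J -> generated_root J a
| GenRefl a b : a \in J -> generated_root J b -> generated_root J (refl a b).

Definition coroot a : V := (2 / dot a a) *: a.
Definition dual Phi : {fset V} := [fset coroot a | a in Phi].

(* p is the orthogonal projection of r to the fixed space of tau. *)
Definition fixed_proj (tau : 'M[R]_n) r p : Prop :=
  p *m tau = p /\ forall v, v *m tau = v -> dot (r - p) v = 0.

Definition diagram_isometry J (rho : {perm J}) (tau : 'M[R]_n) : Prop :=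
  [/\ tau *m tau^T = 1%:M,
      (forall r s : J, bonds (val (rho r)) (val (rho s)) = bonds (val r) (val s))
    & forall r : J, exists2 c : R, 0 < c & val r *m tau = c *: val (rho r)].

(* (Psi, J') is a root system, with simple system, of the Steinberg subgroup
   determined by tau: one representative of each class of positive multiples
   of projections of roots (uniqueness holds as Psi is reduced). *)
Definition steinberg_roots Theta J (tau : 'M[R]_n) Psi J' : Prop :=
  [/\ root_system Psi, simple_system Psi J',
      (forall a, a \in Psi -> exists2 r, r \in Theta & fixed_proj tau r a),
      (forall r p, r \in Theta -> fixed_proj tau r p ->
         exists2 c : R, 0 < c & c *: p \in Psi)
    & (forall a, a \in J' <-> a \in Psi /\
         exists r p (c : R),
           [/\ r \in J, fixed_proj tau r p, 0 < c & a = c *: p])].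

End RootSystems.

Section WeylGroup.
Variables (R : realType) (n : nat) (Phi : {fset 'rV[R]_n}).
Local Notation V := 'rV[R]_n.
Implicit Types (s w : {perm Phi}) (pi J Psi Theta : {fset V}).

Definition acts_as_refl s (a : V) : bool :=
  [forall b : Phi, val (s b) == refl a (val b)].

(* The Weyl group, through its faithful action on Phi. *)
Definition weyl : {group {perm Phi}} :=
  <<[set s | [exists a : Phi, acts_as_refl s (val a)]]>>%G.

(* The linear action on the span of Phi: v = \sum_a c_a a is sent to
   \sum_a c_a (s a).  It is only meaningful for s in weyl (weyl_mxE below) and
   only ever applied to vectors of that span. *)
Definition root_mx s : 'M[R]_(#|{: Phi}|, n) := \matrix_i val (s (enum_val i)).
Definition weyl_mx s : 'M[R]_n := pinvmx (root_mx 1%g) *m root_mx s.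

Lemma weyl_mxE w (a : Phi) : w \in weyl -> val a *m weyl_mx w = val (w a).
Proof.
move=> Ww.
have [g gE]: exists g : 'M[R]_n, forall b : Phi, val (w b) = val b *m g.
  have /gen_prodgP[m [c cP ->]] := Ww.
  elim: m c cP => [|m IH] c cP.
    by exists 1%:M => b; rewrite big_ord0 perm1 mulmx1.
  rewrite big_ord_recr /=.
  have [i|g gE] := IH (fun i => c (widen_ord (leqnSn m) i)); first exact: cP.
  have := cP ord_max; rewrite inE => /existsP[r /forallP rP].
  have lin : linear (refl (val r)).
    move=> k u v.
    have cD : cartan (k *: u + v) (val r) = k * cartan u (val r) + cartan v (val r).
      by rewrite /cartan dotDl mulrDr mulrDl [2 * (k * _)]mulrCA -[k * _ * _]mulrA.
    by rewrite /refl cD scalerDl scalerBr scalerA opprD addrACA.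
  pose L : {linear V -> V} :=
    HB.pack (refl (val r))
      (GRing.isLinear.Build R V V *:%R (refl (val r)) lin).
  exists (g *m lin1_mx L) => b.
  rewrite permM mulmxA -gE mul_rV_lin1 /=; apply/eqP/rP.
have rE : root_mx w = root_mx 1%g *m g.
  by apply/row_matrixP => i; rewrite row_mul !rowK perm1 gE.
have aE : (val a <= root_mx 1%g)%MS.
  have -> : val a = row (enum_rank a) (root_mx 1%g).
    by rewrite rowK perm1 enum_rankK.
  exact: row_sub.
by rewrite /weyl_mx rE mulmxA [LHS]mulmxA mulmxKpV // gE.
Qed.

Lemma weyl_reflP (a : Phi) :
  root_system Phi -> exists2 s, s \in weyl & acts_as_refl s (val a).
Proof.
case=> Phi0 PhiR _.
have refl_in (b : Phi) : refl (val a) (val b) \in Phi by apply: PhiR; apply: valP.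
pose f (b : Phi) : Phi := [` refl_in b].
have daa : dot (val a) (val a) != 0.
  have : val a != 0 by apply: contraNneq Phi0 => <-; apply: valP.
  apply: contra; rewrite /dot mxE psumr_eq0 => [/allP S0|i _]; last first.
    by rewrite mxE -expr2 sqr_ge0.
  apply/eqP/rowP => i; have := S0 i (mem_index_enum i).
  by rewrite !mxE /= mulf_eq0 orbb => /eqP.
have dotD u v (c : R) : dot (u - c *: v) v = dot u v - c * dot v v.
  by rewrite addrC -scaleNr dotDl mulNr addrC.
have fK : involutive f.
  move=> b; apply: val_inj; rewrite /= {1}/refl /cartan dotD.
  rewrite {1}/refl -addrA -opprD -scalerDl.
  set x := cartan _ _; set d := dot (val b) _.
  have xd : x * dot (val a) (val a) = 2 * d by rewrite /x /cartan divfK.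
  rewrite xd (_ : d - 2 * d = - d); last by rewrite mulr2n mulrDl mul1r opprD addNKr.
  by rewrite mulrN mulNr subrr scale0r subr0.
exists (perm (can_inj fK)); last by apply/forallP => b; rewrite permE.
apply: mem_gen; rewrite inE; apply/existsP; exists a.
by apply/forallP => b; rewrite permE.
Qed.

Definition simple_refls pi : {set {perm Phi}} :=
  [set s | [exists a : pi, acts_as_refl s (val a)]].

(* (simple_refls pi ^+ k)%g is the set of products of k simple reflections. *)
Definition weyl_length pi w : nat :=
  xget 0%N [set k | w \in (simple_refls pi ^+ k)%g /\
                    forall j, w \in (simple_refls pi ^+ j)%g -> (k <= j)%N]%classic.

(* The subgroup generated by the elements of H acting on U as the reflection in
   some root of Psi. *)
Definition refl_subgroup (H : {group {perm Phi}}) (U : V -> Prop) Psi :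
    {group {perm Phi}} :=
  <<[set h in H | `[< exists2 a, a \in Psi &
                      forall v, U v -> v *m weyl_mx h = refl a v >]]>>%G.

(* The elements h of H with tau h tau^-1 = h on the span of Theta. *)
Definition steinberg_subgroup (H : {group {perm Phi}}) Theta (tau : 'M[R]_n) :
    {set {perm Phi}} :=
  [set h in H | [forall a : Theta,
     val a *m weyl_mx h *m tau == val a *m tau *m weyl_mx h]].

(* In the next three definitions (Psi, J, H) consists of a root system Psi with
   simple system J and the subgroup H of the Weyl group of Phi which acts
   faithfully as W(Psi) on the span of Psi. *)

(* Extend the diagram, delete nodes, then pass to the Steinberg subgroup of a
   symmetry of the remaining diagram. *)
Definition extension_step Psi J (H : {group {perm Phi}})
    Psi' J' (H' : {group {perm Phi}}) : Prop :=
  exists (J1 Theta : {fset V}) (rho : {perm J1}) (tau : 'M[R]_n),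
    let H1 := refl_subgroup H (fun v => v \in <<Psi>>%VS) Theta in
    [/\ extended_deletion Psi J J1,
        (forall a, a \in Theta <-> generated_root J1 a),
        diagram_isometry rho tau,
        steinberg_roots Theta J1 tau Psi' J'
      & exists2 H2 : {group {perm Phi}},
          H2 = steinberg_subgroup H1 Theta tau :> {set _} &
          H' = refl_subgroup H2 (fun v => v \in <<Theta>>%VS /\ v *m tau = v) Psi'].

(* A diagram is extended only when it is crystallographic, as otherwise it has
   no highest roots. *)
Inductive extended_subsystem pi :
    {fset V} -> {fset V} -> {group {perm Phi}} -> Prop :=
| ExtStart : extended_subsystem pi Phi pi weyl
| ExtStep Psi J H Psi' J' H' :
    extended_subsystem pi Psi J H -> crystallographic Psi ->
    extension_step Psi J H Psi' J' H' ->
    extended_subsystem pi Psi' J' H'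
| ExtDualStep Psi J H Psi' J' H' :
    extended_subsystem pi Psi J H -> crystallographic Psi ->
    extension_step (dual Psi) (dual J) H Psi' J' H' ->
    extended_subsystem pi (dual Psi') (dual J') H'.

Definition SW_subgroup pi (H : {group {perm Phi}}) : Prop :=
  exists Psi J H0 w,
    [/\ extended_subsystem pi Psi J H0, w \in weyl & H = (H0 :^ w)%G].

End WeylGroup.

Section Tabloids.
Variables (K : fieldType) (gT : finGroupType) (G H : {group gT}).

Definition ntab : nat := #|rcosets H G|.

Lemma base_tabloid_in : H :* 1%g \in rcosets H G.
Proof. by apply/rcosetsP; exists 1%g. Qed.

Definition tab_idx (C : {set gT}) : 'I_ntab := enum_rank_in base_tabloid_in C.

Definition tabloid (w : gT) : 'rV[K]_ntab := delta_mx 0 (tab_idx (H :* w)).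

Definition tab_mx (u : gT) : 'M[K]_ntab :=
  \matrix_(i < ntab) delta_mx 0 (tab_idx (enum_val i :* u)).

Lemma tabloid_act w u :
  w \in G -> u \in G -> tabloid w *m tab_mx u = tabloid (w * u)%g.
Proof.
move=> Gw Gu; rewrite /tabloid -rowE rowK; congr (delta_mx _ (tab_idx _)).
by rewrite enum_rankK_in ?rcosetM //; apply/rcosetsP; exists w.
Qed.

Lemma tab_idxP (i : 'I_ntab) : exists2 w, w \in G & i = tab_idx (H :* w).
Proof.
have /rcosetsP[w Gw iE] := enum_valP i; exists w => //.
by rewrite -iE /tab_idx enum_valK_in.
Qed.

Lemma tab_mx_repr : mx_repr G tab_mx.
Proof.
split=> [|u v Gu Gv]; apply/row_matrixP => i; have [w Gw ->] := tab_idxP i.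
  by rewrite !rowE tabloid_act // mulg1 mulmx1.
by rewrite !rowE mulmxA !tabloid_act ?groupM // mulgA.
Qed.

(* M^Delta *)
Definition tab_repr : mx_representation K G ntab :=
  MxRepresentation tab_mx_repr.

(* The bilinear form for which the tabloids are orthonormal. *)
Definition form (u v : 'rV[K]_ntab) : K := (u *m v^T) 0 0.

(* The row space of perp S is the orthogonal complement of the row space of S. *)
Definition perp (S : 'M[K]_ntab) : 'M[K]_ntab := kermx S^T.

Lemma perpP (S : 'M[K]_ntab) (v : 'rV[K]_ntab) :
  reflect (forall u : 'rV_ntab, (u <= S)%MS -> form u v = 0) (v <= perp S)%MS.
Proof.
apply: (iffP sub_kermxP) => [vS u /submxP[x ->]|vS].
  by rewrite /form -mulmxA -[S]trmxK -trmx_mul vS trmx0 mulmx0 mxE.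
rewrite -[LHS]trmxK trmx_mul trmxK -[RHS]trmxK trmx0; congr (_^T).
apply/colP => j; rewrite [RHS]mxE -(vS (row j S) (row_sub j S)).
by rewrite /form -row_mul [RHS]mxE.
Qed.

Lemma tab_mx_orthogonal u : u \in G -> tab_mx u *m (tab_mx u)^T = 1%:M.
Proof.
move=> Gu; apply/matrixP => i j; have [w Gw ->] := tab_idxP i.
have [x Gx ->] := tab_idxP j.
have rE y : y \in G ->
    row (tab_idx (H :* y)) (tab_mx u) = delta_mx 0 (tab_idx (H :* (y * u))).
  by move=> Gy; rewrite rowE tabloid_act.
have idxE y z : y \in G -> z \in G ->
    (tab_idx (H :* y) == tab_idx (H :* z)) = (H :* y == H :* z).
  move=> Gy Gz; apply/eqP/eqP => [|-> //] /enum_rank_in_inj; apply.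
    by apply/rcosetsP; exists y.
  by apply/rcosetsP; exists z.
set A := tab_mx u in rE *; set i' := tab_idx _; set j' := tab_idx _.
have -> : (A *m A^T) i' j' = (row i' A *m A^T) 0 j' by rewrite -row_mul [RHS]mxE.
rewrite rE // -rowE mxE [_^T _ _]mxE.
have -> k : A j' k = row j' A 0 k by rewrite [RHS]mxE.
rewrite rE // !mxE eqxx /= {}/i' {}/j'.
by rewrite !idxE ?groupM // !rcosetM (inj_eq (can_inj (rcosetK u))).
Qed.

Lemma tab_mxV u : u \in G -> tab_mx u^-1%g = (tab_mx u)^T.
Proof.
move=> Gu; rewrite -[LHS]mulmx1 -(tab_mx_orthogonal Gu) mulmxA.
by rewrite -(repr_mxM tab_repr) ?groupV // mulVg (repr_mx1 tab_repr) mul1mx.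
Qed.

Variables (sgn : gT -> K) (H' : {group gT}).

Definition kappa (v : 'rV[K]_ntab) : 'rV[K]_ntab :=
  \sum_(s in H') sgn s *: (v *m tab_repr s).

(* e_{J,J'} *)
Definition polytabloid : 'rV[K]_ntab := kappa (tabloid 1%g).

(* S^{J,J'} *)
Definition specht : 'M[K]_ntab :=
  (\sum_(w in G) <<polytabloid *m tab_repr w>>)%MS.

Lemma specht_module : mxmodule tab_repr specht.
Proof.
apply/mxmoduleP => u Gu; rewrite /specht sumsmxMr; apply/sumsmx_subP => w Gw.
rewrite (eqmxMr _ (genmxE _)) -mulmxA -repr_mxM //.
by apply: (sumsmx_sup (w * u)%g); rewrite ?groupM // genmxE.
Qed.

Lemma perp_module (S : 'M[K]_ntab) :
  mxmodule tab_repr S -> mxmodule tab_repr (perp S).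
Proof.
move=> modS; apply/mxmoduleP => u Gu.
apply/rV_subP => _ /submxP[x ->]; rewrite mulmxA.
have /perpP vS : (x *m perp S <= perp S)%MS by apply: submxMl.
apply/perpP => y yS; move: (x *m _) vS => v vS.
have <- : form (y *m tab_mx u^-1%g) v = form y (v *m tab_repr u).
  by rewrite /form tab_mxV // trmx_mul mulmxA.
by apply: vS; apply: (mxmodule_trans modS (groupVr Gu) yS).
Qed.

Lemma radical_module : mxmodule tab_repr (specht :&: perp specht)%MS.
Proof. exact: capmx_module specht_module (perp_module specht_module). Qed.

(* The section S / (S :&: S^perp), of dimension specht_quot_dim. *)
Definition specht_quot_dim : nat :=
  \rank <<in_factmod (specht :&: perp specht)%MS specht>>%MS.

Definition specht_quot : mx_representation K G specht_quot_dim :=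
  section_repr radical_module specht_module.

End Tabloids.

Section Duals.
Variables (R : realType) (n : nat) (Phi pi : {fset 'rV[R]_n}) (K : fieldType).
Implicit Types H : {group {perm Phi}}.

(* s(w), as an element of K. *)
Definition weyl_sign (w : {perm Phi}) : K := (-1) ^+ weyl_length pi w.

Definition useful_dual H H' : Prop :=
  SW_subgroup pi H' /\ H :&: H' = 1%g.

Definition good_dual H H' : Prop :=
  useful_dual H H' /\
  forall w, w \in weyl Phi ->
    kappa weyl_sign H' (tabloid K (weyl Phi) H w) != 0 ->
    polytabloid (weyl Phi) H weyl_sign H' 0 (tab_idx (weyl Phi) H (H :* w)) != 0.

(* D^J *)
Definition DJ_dim H H' : nat := specht_quot_dim (weyl Phi) H weyl_sign H'.
Definition DJ H H' : mx_representation K (weyl Phi) (DJ_dim H H') :=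
  specht_quot (weyl Phi) H weyl_sign H'.

End Duals.

(* Main.v *)
(* The element kappa of K[W] attached to W(J') is self-adjoint for the form, and
   the good dual condition makes kappa send every tabloid to a
   multiple of e = e_{J,J'}: a tabloid not killed by kappa is sigma{J} for some
   sigma in W(J').  Hence (James's submodule theorem) a submodule U of M^Delta
   with kappa U != 0 contains e and so S, while kappa U = 0 gives
   <U, S> = <kappa U, tabloids> = 0.
   What this needs from the Weyl group is that s is a homomorphism.  The product over the
   positive roots b of the sign of w b changes sign with each simple reflection,
   as a simple reflection permutes the positive roots other than its own; and
   the simple reflections generate the group. *)
Require Import Defs.
From mathcomp Require Import all_boot all_order all_fingroup all_algebra.
From mathcomp Require Import mxrepresentation finmap boolp classical_sets reals ring.

Set Implicit Arguments.
Unset Strict Implicit.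
Unset Printing Implicit Defensive.

Import Order.TTheory GRing.Theory Num.Theory GroupScope.
Local Open Scope ring_scope.

(** * The submodule theorem for a signed sum over a subgroup of a finite group *)

Section SubmoduleTheorem.
Variables (K : fieldType) (gT : finGroupType) (G H H' : {group gT}).
Variable sgn : gT -> K.
Hypothesis sH'G : H' \subset G.
Hypothesis sgn1 : sgn 1%g = 1.
Hypothesis sgnM : {in H' &, {morph sgn : s t / (s * t)%g >-> s * t}}.
Hypothesis sgnV : {in H', forall s, sgn s^-1%g = sgn s}.

Local Notation M := (tab_repr K G H).
Local Notation e := (polytabloid G H sgn H').
Local Notation S := (specht G H sgn H').

(** The matrix form turns self-adjointness of [kappa] into symmetry and its image into a row
    space. *)
Definition kappa_mx : 'M[K]_(ntab G H) := \sum_(s in H') sgn s *: tab_mx K G H s.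

Lemma kappaE (v : 'rV_(ntab G H)) : kappa sgn H' v = v *m kappa_mx.
Proof. by rewrite mulmx_sumr; apply: eq_bigr => s _; rewrite -scalemxAr. Qed.

(** Tabloids are orthonormal, so transposing the action of [s] gives that of [s^-1], which has the
    same sign; inversion merely reorders the sum. *)
Lemma kappa_mx_tr : kappa_mx^T = kappa_mx.
Proof.
rewrite /kappa_mx linear_sum (reindex_inj invg_inj).
apply: eq_big => s; first by rewrite groupV.
rewrite groupV => H's; rewrite linearZ /= sgnV // tab_mxV ?trmxK //.
exact: (fintype.subsetP sH'G).
Qed.

(** Translation by [t] permutes the summands, and [sgn t] is its own inverse. *)
Lemma tab_mx_kappa_mx t :
  t \in H' -> tab_mx K G H t *m kappa_mx = sgn t *: kappa_mx.
Proof.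
move=> H't; have GH' := fintype.subsetP sH'G.
rewrite {1}/kappa_mx mulmx_sumr /kappa_mx [in RHS](reindex_inj (mulgI t)).
rewrite scaler_sumr; apply: eq_big => s; first by rewrite groupMl.
move=> H's; rewrite scalerA -scalemxAr -(repr_mxM M) ?GH' //; congr (_ *: _).
by rewrite sgnM // mulrA -{1}(sgnV H't) -sgnM ?groupV // mulVg sgn1 mul1r.
Qed.

Hypothesis good : forall w, w \in G -> kappa sgn H' (tabloid K G H w) != 0 ->
  e 0 (tab_idx G H (H :* w)) != 0.

Lemma kappa_tabloid_sub w : w \in G -> (kappa sgn H' (tabloid K G H w) <= e)%MS.
Proof.
move=> Gw; have [-> | nz] := eqVneq (kappa sgn H' (tabloid K G H w)) 0.
  exact: sub0mx.
have GH' := fintype.subsetP sH'G.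
(* The tabloids occurring in [e] are among the [H :* s] with [s] in [H']; by the good dual condition
   [H :* w] is one of them, and [kappa] sends it to [sgn s] times [e]. *)
have [s H's iE] : exists2 s, s \in H' &
    tab_idx G H (H :* s) = tab_idx G H (H :* w).
  apply: contrapT => no; have := good Gw nz.
  rewrite /polytabloid /kappa summxE big1 ?eqxx // => s H's.
  rewrite [LHS]mxE /= tabloid_act ?GH' // mul1g /tabloid mxE eqxx /= eq_sym.
  by case: eqP => [iE | _]; [case: no; exists s | rewrite mulr0].
rewrite /tabloid -iE -/(tabloid K G H s) -[s in tabloid _ _ _ s]mul1g.
rewrite -tabloid_act ?GH' // kappaE -mulmxA tab_mx_kappa_mx // -scalemxAr.
by rewrite scalemx_sub // /polytabloid kappaE.
Qed.

Lemma kappa_mx_sub : (kappa_mx <= e)%MS.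
Proof.
apply/row_subP => i; have [w Gw ->] := tab_idxP i.
by rewrite rowE -kappaE; apply: kappa_tabloid_sub.
Qed.

Lemma specht_sub (W : 'M_(ntab G H)) : mxmodule M W -> (e <= W)%MS -> (S <= W)%MS.
Proof.
move=> modW eW; apply/sumsmx_subP => w Gw.
by rewrite genmxE; apply: mxmodule_trans.
Qed.

(** The two alternatives correspond to whether [kappa] is nonzero on [W] or kills it. *)
Lemma submodule_theorem (W : 'M_(ntab G H)) :
  mxmodule M W -> (S <= W)%MS \/ (W <= perp S)%MS.
Proof.
move=> modW; have GH' := fintype.subsetP sH'G.
have [kW0 | kWn0] := eqVneq (W *m kappa_mx) 0; [right | left].
  (* The form is symmetric, so orthogonality may be checked starting from [S]. *)
  suff /sub_kermxP SW : (S <= kermx W^T)%MS.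
    by apply/sub_kermxP; rewrite -[LHS]trmxK trmx_mul trmxK SW trmx0.
  apply/sumsmx_subP => w Gw; rewrite genmxE; apply/sub_kermxP.
  have /submxP[X XE] : (W *m tab_mx K G H w^-1 <= W)%MS.
    by apply: (mxmoduleP modW); rewrite groupV.
  (* Both [kappa] and [w] cross to the other side of the form, where [w] becomes [w^-1] and keeps
     [W] stable. *)
  rewrite /polytabloid kappaE /= -kappa_mx_tr -[tab_mx K G H w]trmxK -tab_mxV //.
  by rewrite -!mulmxA -!trmx_mul XE -mulmxA kW0 mulmx0 trmx0 mulmx0.
have kWW : (W *m kappa_mx <= W)%MS.
  rewrite mulmx_sumr; apply: summx_sub => s H's.
  by rewrite -scalemxAr scalemx_sub // (mxmoduleP modW) ?GH'.
(* A nonzero row of [W *m kappa_mx] lies in [W] and is a nonzero multiple of [e]. *)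
have [i rn0] : exists i, row i (W *m kappa_mx) != 0.
  apply: contrapT => no; case/eqP: kWn0; apply/row_matrixP => i.
  by rewrite row0; apply/eqP/negPn/negP => rn0; apply: no; exists i.
have /sub_rVP[c rE] : (row i (W *m kappa_mx) <= e)%MS.
  by rewrite row_mul (submx_trans _ kappa_mx_sub) ?submxMl.
have c0 : c != 0 by apply: contraNneq rn0 => c0; rewrite rE c0 scale0r.
apply: specht_sub => //; rewrite -(eqmx_scale e c0) -rE.
exact: submx_trans (row_sub _ _) kWW.
Qed.

Lemma specht_quot_irr :
  specht_quot_dim G H sgn H' = 0%N \/ mx_irreducible (specht_quot G H sgn H').
Proof.
have [SP | nSP] := boolP (S <= perp S)%MS; [left | right].
  apply/eqP; rewrite /specht_quot_dim genmxE mxrank_eq0 in_factmod_eq0.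
  by rewrite sub_capmx submx_refl.
(* Irreducibility of the section means that the radical is a maximal submodule of [S]; the dichotomy
   leaves no room for an intermediate [W]. *)
apply/max_submodP; first exact: capmxSl.
split=> [|W [modW /andP[_ nWR] /andP[WS nSW]]].
  by rewrite ltmxE capmxSl sub_capmx submx_refl.
have [SW | WP] := submodule_theorem modW; first by rewrite SW in nSW.
by rewrite sub_capmx WS WP in nWR.
Qed.
End SubmoduleTheorem.

(** * Euclidean geometry of reflections *)

Section Reflections.
Variables (R : realType) (n : nat).
Local Notation V := 'rV[R]_n.
Implicit Types (a b x y : V) (J : {fset V}).

Lemma dotC x y : dot x y = dot y x.
Proof. by rewrite /dot -[in LHS](trmxK x) -trmx_mul mxE. Qed.

Lemma dot0l y : dot 0 y = 0.
Proof. by rewrite /dot mul0mx mxE. Qed.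

Lemma dotBZl x y (k : R) b : dot (x - k *: y) b = dot x b - k * dot y b.
Proof. by rewrite addrC -scaleNr dotDl mulNr addrC. Qed.

Lemma dotBZr x y (k : R) b : dot b (x - k *: y) = dot b x - k * dot b y.
Proof. by rewrite dotC dotBZl !(dotC b). Qed.

Lemma dot_sumr J (c : V -> R) x :
  dot x (\sum_(b <- J) c b *: b) = \sum_(b <- J) c b * dot x b.
Proof.
rewrite dotC; elim/big_rec2: _ => [|b u v _ <-]; first exact: dot0l.
by rewrite dotDl (dotC b).
Qed.

Lemma dot_gt0 x : x != 0 -> 0 < dot x x.
Proof.
move=> x0; have ge0 (i : 'I_n) : 0 <= x 0 i * x^T i 0 by rewrite mxE -expr2 sqr_ge0.
rewrite /dot mxE lt_def sumr_ge0 // andbT; apply: contra x0.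
rewrite psumr_eq0 // => /allP S0; apply/eqP/rowP => i.
by have := S0 i (mem_index_enum i); rewrite !mxE /= mulf_eq0 orbb => /eqP.
Qed.

Lemma refl_self a : a != 0 -> refl a a = - a.
Proof.
move=> /dot_gt0/lt0r_neq0 aa0.
by rewrite /refl /cartan mulfK // scaler_nat mulr2n opprD addNKr.
Qed.

Lemma reflN a x : refl (- a) x = refl a x.
Proof.
have dN y : dot y (- a) = - dot y a by rewrite /dot linearN mulmxN mxE.
by rewrite /refl /cartan !dN (dotC (- a)) dN opprK mulrN mulNr scaleNr scalerN opprK.
Qed.

Lemma cartanK x a : a != 0 -> cartan x a * dot a a = 2 * dot x a.
Proof. by move=> /dot_gt0/lt0r_neq0 aa0; rewrite divfK. Qed.

Lemma refl_isometry a x y : a != 0 -> dot (refl a x) (refl a y) = dot x y.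
Proof.
move=> /dot_gt0/lt0r_neq0 aa0.
by rewrite /refl dotBZr !dotBZl (dotC a y) /cartan; field.
Qed.

Lemma reflK a : a != 0 -> involutive (refl a).
Proof.
move=> a0 x.
rewrite {1}/refl {1}/refl -addrA -opprD -scalerDl (_ : cartan x a + _ = 0).
  by rewrite scale0r subr0.
apply: (mulIf (lt0r_neq0 (dot_gt0 a0))); rewrite mul0r mulrDl !cartanK //.
rewrite /refl dotBZl cartanK //; ring.
Qed.

(** Conjugating a reflection by an isometry reflects in the image vector. *)
Lemma refl_refl a b x : a != 0 -> refl (refl a b) (refl a x) = refl a (refl b x).
Proof.
move=> a0; rewrite {1}/refl {1}/cartan !refl_isometry // -/(cartan x b).
have cD : cartan (x - cartan x b *: b) a = cartan x a - cartan x b * cartan b a.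
  by rewrite /cartan dotBZl mulrBr mulrBl mulrCA -!mulrA.
rewrite [RHS]/refl [refl b x]/refl cD scalerBl /refl scalerBr scalerA !opprB.
by rewrite addrACA [RHS]addrACA; congr (_ + _); rewrite addrC.
Qed.

Lemma free_coef J (c d : V -> R) : free J ->
  \sum_(b <- J) c b *: b = \sum_(b <- J) d b *: b -> {in J, c =1 d}.
Proof.
move=> freeJ /eqP; rewrite -subr_eq0 -sumrB (big_nth 0) big_mkord => /eqP S0 b Jb.
have lt_b : (index b J < size J)%N by rewrite index_mem.
pose k (i : 'I_(size J)) := c J`_i - d J`_i.
have /(_ k) := @freeP _ _ _ (in_tuple J) freeJ.
rewrite /= => /(_ _ (Ordinal lt_b)); rewrite /k /= nth_index // => H.
apply/eqP; rewrite -subr_eq0 H // -[RHS]S0.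
by apply: eq_bigr => i _; rewrite scalerBl.
Qed.
End Reflections.

(** * Positive roots and generation by simple reflections *)

Section PositiveRoots.
Variables (R : realType) (n : nat) (Phi pi : {fset 'rV[R]_n}).
Hypotheses (rootPhi : root_system Phi) (simple : simple_system Phi pi).
Local Notation V := 'rV[R]_n.
Implicit Types (a b c x y : Phi) (s w : {perm Phi}).

Definition pos b : bool := `[< nneg_comb pi (val b) >].
Definition simple_root a : bool := val a \in pi.

Lemma root_neq0 a : val a != 0.
Proof. by case: rootPhi => Phi0 _ _; apply: contraNneq Phi0 => <-; apply: valP. Qed.

Lemma simple_val (a : V) : a \in pi -> exists2 a' : Phi, val a' = a & simple_root a'.
Proof.
move=> pa; case: simple => /fsubsetP/(_ a pa) Pa _ _.
by exists [` Pa]%fset.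
Qed.

Lemma simple_pos a : simple_root a -> pos a.
Proof.
move=> pa; apply/asboolP; exists (fun v => (v == val a)%:R).
  by move=> b; rewrite ler0n.
rewrite (big_fsetD1 _ pa) /= eqxx scale1r big_seq big1 ?addr0 // => b.
by rewrite !inE => /andP[/negPf -> _]; rewrite scale0r.
Qed.

Lemma nneg_comb_opp (v : V) : nneg_comb pi v -> nneg_comb pi (- v) -> v = 0.
Proof.
case: simple => _ freepi _ [c c0 cE] [d d0 dE].
have eq0 : {in pi, c =1 (fun=> 0)}.
  have cd : {in pi, c =1 (fun v => - d v)}.
    apply: free_coef => //; rewrite -cE -[LHS]opprK dE -sumrN.
    by apply: eq_bigr => b _; rewrite scaleNr.
  by move=> b pb; apply/eqP; rewrite eq_le c0 cd // oppr_le0 d0.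
rewrite cE big_seq big1 // => b pb.
by rewrite eq0 // scale0r.
Qed.

Lemma neg_root b c : val c = - val b -> pos c = ~~ pos b.
Proof.
move=> cE; apply/idP/idP => [/asboolP pc | npb].
  apply/negP => /asboolP pb; case/eqP: (root_neq0 b).
  by apply: nneg_comb_opp; rewrite -?cE.
case: simple => _ _ /(_ _ (valP b))[pb | nb]; first by case/asboolP: npb.
by apply/asboolP; rewrite cE.
Qed.

(** The reflection changes only the coefficient of [a]. Were the image negative, all other
    coefficients of [b] would vanish, and reducedness would force [b] to be [a]. *)
Lemma simple_refl_pos s a b : acts_as_refl s (val a) ->
  simple_root a -> pos b -> b != a -> pos (s b).
Proof.
move=> /forallP/(_ b)/eqP sb pa /asboolP[c c0 bE] nba; apply: contrapT => nps.
case: simple => _ freepi /(_ _ (valP (s b)))[ps | [d d0 dE]].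
  by case: nps; apply/asboolP.
have eq0 : {in pi, forall v, v != val a -> c v = 0}.
  pose k := cartan (val b) (val a).
  have : {in pi, (fun v => c v - k * (v == val a)%:R) =1 (fun v => - d v)}.
    apply: free_coef => //.
    under [RHS]eq_bigr do rewrite scaleNr.
    rewrite sumrN -dE opprK sb /refl -/k.
    under eq_bigr do rewrite scalerBl; rewrite sumrB -bE; congr (_ - _).
    rewrite (big_fsetD1 _ pa) /= eqxx mulr1 big_seq big1 ?addr0 // => v.
    by rewrite !inE => /andP[/negPf -> _]; rewrite mulr0 scale0r.
  move=> cd v pv nva; apply/eqP; rewrite eq_le c0 andbT.
  by have := cd v pv; rewrite /= (negPf nva) mulr0 subr0 => ->; rewrite oppr_le0.
have {}bE : val b = c (val a) *: val a.
  rewrite bE (big_fsetD1 _ pa) /= big_seq big1 ?addr0 // => v.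
  by rewrite !inE => /andP[nva pv]; rewrite eq0 // scale0r.
case: rootPhi => _ _ /(_ _ (valP a) (c (val a))); rewrite -bE => /(_ (valP b)).
case=> c1; first by case/eqP: nba; apply: val_inj; rewrite bE c1 scale1r.
by have := c0 (val a); rewrite c1 ler0N1.
Qed.

(** The usual height on the span of [pi]; [coord] makes it linear on all of [V], so no span
    membership has to be tracked. *)
Definition height : V -> R := fun v => \sum_i coord (in_tuple pi) i v.

Lemma height_refl (a v : V) : a \in pi -> height (refl a v) = height v - cartan v a.
Proof.
case: simple => _ freepi _ pa; rewrite /height.
have lt_a : (index a pi < size pi)%N by rewrite index_mem.
have aE : a = (in_tuple pi)`_(Ordinal lt_a) by rewrite /= nth_index.
rewrite -[X in _ - X]mulr1.
have <- : \sum_i coord (in_tuple pi) i a = 1.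
  rewrite {1}aE (bigD1 (Ordinal lt_a)) //= big1 ?addr0 => [|i ia].
    by rewrite (@coord_free _ _ _ (in_tuple pi) (Ordinal lt_a)) // eqxx.
  rewrite (@coord_free _ _ _ (in_tuple pi) (Ordinal lt_a)) //.
  by rewrite eq_sym (negPf ia).
by rewrite mulr_sumr -sumrB; apply: eq_bigr => i _; rewrite linearB linearZ.
Qed.

(** Otherwise expanding one factor of [dot b b] in simple roots would give a nonpositive value. *)
Lemma pos_dot_simple b : pos b -> exists2 a, simple_root a & 0 < dot (val b) (val a).
Proof.
move=> /asboolP[c c0 bE]; apply: contrapT => no.
have := dot_gt0 (root_neq0 b); rewrite {2}bE dot_sumr ltNge => /negP[].
rewrite big_seq sumr_le0 // => v pv; rewrite mulr_ge0_le0 // leNgt.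
by apply/negP => dv; have [a aE pa] := simple_val pv; case: no; exists a; rewrite ?aE.
Qed.

(** The rule that conjugating the reflection in [b] by [w] gives the reflection in [w b]. Naming the
    reflected root [y] lets a mere permutation of roots satisfy it. *)
Definition equivariant w : Prop := forall b x y,
  val y = refl (val b) (val x) -> val (w y) = refl (val (w b)) (val (w x)).

Lemma weyl_equivariant w : w \in weyl Phi -> equivariant w.
Proof.
move=> /gen_prodgP[m [c cP ->]]; elim: m c cP => [|m IH] c cP.
  by rewrite big_ord0 => b x y; rewrite !perm1.
rewrite big_ord_recr /= => b x y /IH yE; rewrite !permM.
have := cP ord_max; rewrite inE => /existsP[a /forallP aP].
rewrite !(eqP (aP _)) yE ?refl_refl ?root_neq0 // => i; exact: cP.
Qed.

Lemma weyl_opp w b c : w \in weyl Phi -> val c = - val b -> val (w c) = - val (w b).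
Proof.
move=> /weyl_equivariant eqw cE.
by rewrite (eqw b b c) ?refl_self ?root_neq0.
Qed.

Lemma simple_refls_sub : simple_refls Phi pi \subset weyl Phi.
Proof.
apply/fintype.subsetP => s; rewrite inE => /existsP[a sa].
have [a' aE _] := simple_val (valP a).
by apply: mem_gen; rewrite inE; apply/existsP; exists a'; rewrite aE.
Qed.

Lemma mem_simple_refls s a :
  simple_root a -> acts_as_refl s (val a) -> s \in simple_refls Phi pi.
Proof. by move=> pa sa; rewrite inE; apply/existsP; exists [` pa]%fset. Qed.

Lemma simple_reflsP s : s \in simple_refls Phi pi ->
  exists2 a, simple_root a & acts_as_refl s (val a).
Proof.
rewrite inE => /existsP[a sa]; have [a' aE pa'] := simple_val (valP a).
by exists a'; rewrite ?aE.
Qed.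

(* A positive root of least height in the orbit is simple: otherwise some
   simple reflection would lower its height and keep it positive. *)
Lemma pos_conj_simple b : pos b ->
  exists2 w, w \in <<simple_refls Phi pi>>%g & simple_root (w b).
Proof.
move=> pb; pose P := [pred c | pos c & [exists w in <<simple_refls Phi pi>>%g, w b == c]].
have Pb : P b by rewrite inE pb; apply/exists_inP; exists 1%g; rewrite ?perm1.
case: (arg_minP (fun c => height (val c)) Pb) => c.
move=> /andP[pc /exists_inP[w Ww /eqP wb]] minc.
exists w => //; rewrite wb.
have [a pa dca] := pos_dot_simple pc.
have [s _ sa] := weyl_reflP a rootPhi.
have [-> // | nca] := eqVneq c a.
have /minc : P (s c).
  rewrite inE (simple_refl_pos sa) //; apply/exists_inP; exists (w * s)%g.
    by rewrite groupM // mem_gen // (mem_simple_refls pa).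
  by rewrite permM wb.
rewrite (eqP (forallP sa c)) height_refl // lerBrDr gerDl leNgt => /negP[].
by rewrite /cartan divr_gt0 ?mulr_gt0 ?dot_gt0 ?root_neq0.
Qed.

Lemma weyl_gen_simple : weyl Phi = <<simple_refls Phi pi>>%g :> {set _}.
Proof.
apply/eqP; rewrite finset.eqEsubset gen_subG gen_subG simple_refls_sub andbT.
(* A root and its negative define the same reflection, so [b] may be taken positive. *)
suff posP s b : pos b -> acts_as_refl s (val b) -> s \in <<simple_refls Phi pi>>%g.
  apply/fintype.subsetP => s; rewrite inE => /existsP[b sb].
  have [pb | npb] := boolP (pos b); first exact: posP sb.
  have sbb : val (s b) = - val b by rewrite (eqP (forallP sb b)) refl_self ?root_neq0.
  apply: (posP s (s b)); first by rewrite (neg_root sbb).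
  by apply/forallP => x; rewrite sbb reflN; apply: (forallP sb).
move=> pb sb; have [w Ww pw] := pos_conj_simple pb.
have [t _ ta] := weyl_reflP (w b) rootPhi.
have eqw : equivariant w.
  apply: weyl_equivariant; move: Ww; apply/fintype.subsetP.
  by rewrite gen_subG simple_refls_sub.
have tW : t \in <<simple_refls Phi pi>>%g by rewrite mem_gen // (mem_simple_refls pw).
(* With [w] carrying [b] to a simple root, the reflection in [b] is a conjugate of a simple one. *)
suff -> : s = (w * t * w^-1)%g by rewrite !groupM ?groupV.
apply: (mulIg w); rewrite mulgKV; apply/permP => x; rewrite !permM.
apply: val_inj; rewrite (eqP (forallP ta _)); apply: eqw.
exact: eqP (forallP sb x).
Qed.

Lemma weyl_word w : w \in weyl Phi -> exists k, w \in (simple_refls Phi pi ^+ k)%g.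
Proof.
rewrite weyl_gen_simple => /gen_prodgP[k [c cP ->]]; exists k.
elim: k c cP => [|k IH] c cP; first by rewrite big_ord0 expg0 set11.
by rewrite big_ord_recl expgS mem_mulg // IH.
Qed.

Lemma weyl_lengthP w : w \in weyl Phi ->
  w \in (simple_refls Phi pi ^+ weyl_length pi w)%g.
Proof.
move=> /weyl_word exk; have ex : exists k, w \in (simple_refls Phi pi ^+ k)%g by [].
rewrite /weyl_length.
set P := [set k | _]%classic.
(* A shortest word exists, so [xget] returns its length and not the default. *)
have : P (xget 0%N P).
  apply: xgetPex; exists (ex_minn ex); case: ex_minnP => m wm mmin.
  by split.
by case.
Qed.

(** * The sign as a character of the Weyl group *)

Variable K : fieldType.

Definition root_sign b : K := if pos b then 1 else -1.

(* (-1) to the number of positive roots made negative by w *)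
Definition inversion_sign w : K := \prod_(b | pos b) root_sign (w b).

Lemma inversion_sign_mul s w : s \in simple_refls Phi pi -> w \in weyl Phi ->
  inversion_sign (s * w)%g = - inversion_sign w.
Proof.
move=> /simple_reflsP[a pa sa] Ww.
have pos_a := simple_pos pa.
have saE : val (s a) = - val a by rewrite (eqP (forallP sa a)) refl_self ?root_neq0.
have sK : involutive s.
  move=> b; apply: val_inj; rewrite (eqP (forallP sa _)) (eqP (forallP sa _)).
  by rewrite reflK ?root_neq0.
(* The factor at [a] changes sign since [s a] is the negative of [a]; the remaining factors are
   permuted by [s]. *)
rewrite /inversion_sign (bigD1 a) //= [in RHS](bigD1 a) //= -mulNr; congr (_ * _).
  rewrite permM /root_sign (neg_root (weyl_opp Ww saE)).
  by case: (pos _); rewrite ?opprK.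
have stable b : pos b && (b != a) -> pos (s b) && (s b != a).
  case/andP=> pb nba; rewrite (simple_refl_pos sa) //=.
  apply: contraTneq pb => sba; rewrite -[b]sK sba.
  by rewrite (neg_root saE) negbK.
rewrite (reindex_inj (can_inj sK)); apply: eq_big => b; last by rewrite permM sK.
by apply/idP/idP => /stable; rewrite ?sK.
Qed.

Lemma inversion_sign_word k w : w \in (simple_refls Phi pi ^+ k)%g ->
  w \in weyl Phi /\ inversion_sign w = (-1) ^+ k.
Proof.
elim: k w => [|k IH] w.
  rewrite expg0 => /set1P ->; split; first exact: group1.
  by rewrite expr0 /inversion_sign big1 // => b pb; rewrite perm1 /root_sign pb.
rewrite expgS => /mulsgP[s v Ss /IH[Wv vE] ->]; split.
  by rewrite groupM // (fintype.subsetP simple_refls_sub).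
by rewrite inversion_sign_mul // vE exprS mulN1r.
Qed.

(** Any word, not only a shortest one, computes the sign, since [inversion_sign] does not depend on
    the word. *)
Lemma weyl_sign_word k w :
  w \in (simple_refls Phi pi ^+ k)%g -> weyl_sign pi K w = (-1) ^+ k.
Proof.
move=> /inversion_sign_word[Ww <-].
by have [_ ->] := inversion_sign_word (weyl_lengthP Ww).
Qed.

Lemma weyl_sign1 : weyl_sign pi K (1%g : {perm Phi}) = 1.
Proof. by rewrite (@weyl_sign_word 0) ?expr0 // expg0 set11. Qed.

Lemma weyl_signM :
  {in weyl Phi &, {morph weyl_sign pi K : s t / (s * t)%g >-> s * t}}.
Proof.
move=> s t /weyl_word[j sj] /weyl_word[k tk].
have stjk : (s * t)%g \in (simple_refls Phi pi ^+ (j + k))%g.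
  by rewrite expgD mem_mulg.
by rewrite (weyl_sign_word sj) (weyl_sign_word tk) (weyl_sign_word stjk) exprD.
Qed.

Lemma weyl_signV : {in weyl Phi, forall s, weyl_sign pi K s^-1%g = weyl_sign pi K s}.
Proof.
move=> s Ws; have ss1 : weyl_sign pi K s * weyl_sign pi K s = 1.
  by rewrite -expr2 /weyl_sign sqrr_sign.
rewrite -[LHS]mulr1 -ss1 mulrA -weyl_signM ?groupV //.
by rewrite mulVg weyl_sign1 mul1r.
Qed.

End PositiveRoots.

(** * Containment of the SW-subgroups in the Weyl group *)

Section SWSubgroups.
Variables (R : realType) (n : nat) (Phi : {fset 'rV[R]_n}).

Lemma refl_subgroup_sub (H : {group {perm Phi}}) U Psi :
  refl_subgroup H U Psi \subset H.
Proof. by rewrite gen_subG; apply/fintype.subsetP => h; rewrite inE => /andP[]. Qed.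

(** Each stage of the step selects elements of the previous group or generates a subgroup from such
    elements. *)
Lemma extension_step_sub Psi J (H : {group {perm Phi}}) Psi' J' H' :
  extension_step Psi J H Psi' J' H' -> H' \subset H.
Proof.
move=> [J1 [Theta [rho [tau [_ _ _ _ [H2 H2E ->]]]]]].
apply: fintype.subset_trans (refl_subgroup_sub _ _ _) _.
rewrite H2E; apply: fintype.subset_trans (refl_subgroup_sub H _ _).
by apply/fintype.subsetP => h; rewrite inE => /andP[Hh _]; exact: Hh.
Qed.

Lemma extended_subsystem_sub pi Psi J (H : {group {perm Phi}}) :
  extended_subsystem pi Psi J H -> H \subset weyl Phi.
Proof.
elim=> [|??????? IH _ /extension_step_sub st|??????? IH _ /extension_step_sub st] //.
  exact: fintype.subset_trans st IH.
exact: fintype.subset_trans st IH.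
Qed.

Lemma SW_subgroup_sub pi (H : {group {perm Phi}}) :
  SW_subgroup pi H -> H \subset weyl Phi.
Proof.
move=> [Psi [J [H0 [w [/extended_subsystem_sub sub Ww ->]]]]].
by rewrite /= -(conjGid Ww) conjSg.
Qed.
End SWSubgroups.

Theorem theorem4p19 (R : realType) (n : nat) (Phi pi : {fset 'rV[R]_n})
    (K : fieldType) (H H' : {group {perm Phi}}) :
  root_system Phi -> crystallographic Phi -> simple_system Phi pi ->
  SW_subgroup pi H -> good_dual pi K H H' ->
  DJ_dim pi K H H' = 0%N \/ mx_irreducible (DJ pi K H H').
Proof.
move=> rootPhi _ simple _ [[SWH' _] good].
(* This containment lets the sign rules on the Weyl group restrict to [H']. *)
have sH'W := SW_subgroup_sub SWH'; have WH' := fintype.subsetP sH'W.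
apply: specht_quot_irr => //.
- exact: weyl_sign1.
- by move=> s t /WH' Ws /WH' Wt; apply: weyl_signM.
- by move=> s /WH' Ws; apply: weyl_signV.
Qed.
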